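(* Let $T_1$ and $T_2$ be two $2\times 2$ contingency tables and suppose that Simpson's paradox occurs for $T_1$ and $T_2$. Then the following conditions hold: 1. $A_1\neq A_2$; 2. $C_1\neq C_2$; 3. $\alpha_1\neq\gamma_1$ or $\alpha_2\neq\gamma_2$.
   Context: A $2\times 2$ contingency table has entries that are positive real numbers. For two such tables $T_i=\begin{pmatrix} a_i & b_i\\ c_i& d_i\end{pmatrix}$, $i=1,2$, put $\alpha_i=a_i+b_i$, $\gamma_i=c_i+d_i$, $A_i=a_i/\alpha_i$, $C_i=c_i/\gamma_i$, and $\mu=\frac{a_1+a_2}{\alpha_1+\alpha_2}$, $\nu=\frac{c_1+c_2}{\gamma_1+\gamma_2}$. Simpson's paradox (SP) is said to occur (hold) for $T_1$ and $T_2$ if at least one of the following holds: (SP$_1$) $A_1>C_1$ and $A_2>C_2$ and not $(\mu>\nu)$; (SP$_2$) $A_1<C_1$ and $A_2<C_2$ and not $(\mu<\nu)$. *)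

(* Defs.v *)
From Stdlib Require Import Reals.
Local Open Scope R_scope.

(* The table with rows (a, b) and (c, d). *)
Record table : Set := Table {
  ta : R; tb : R; tc : R; td : R;
  ta_pos : 0 < ta; tb_pos : 0 < tb; tc_pos : 0 < tc; td_pos : 0 < td
}.

Definition alpha (T : table) : R := ta T + tb T.
Definition gamma (T : table) : R := tc T + td T.

Definition rateA (T : table) : R := ta T / alpha T.
Definition rateC (T : table) : R := tc T / gamma T.

Definition mu (T1 T2 : table) : R := (ta T1 + ta T2) / (alpha T1 + alpha T2).
Definition nu (T1 T2 : table) : R := (tc T1 + tc T2) / (gamma T1 + gamma T2).

Definition SP1 (T1 T2 : table) : Prop :=
  rateA T1 > rateC T1 /\ rateA T2 > rateC T2 /\ ~ (mu T1 T2 > nu T1 T2).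

Definition SP2 (T1 T2 : table) : Prop :=
  rateA T1 < rateC T1 /\ rateA T2 < rateC T2 /\ ~ (mu T1 T2 < nu T1 T2).

Definition simpson_paradox (T1 T2 : table) : Prop := SP1 T1 T2 \/ SP2 T1 T2.

(* Main.v *)
(** The aggregate rates [mu] and [nu] are weighted means of the rates of the two
    tables, with weights [alpha] and [gamma] respectively.  A weighted mean is
    strictly monotone in its values for fixed weights, and does not depend on
    the weights when its two values agree.  So if [alpha] and [gamma] agree, or
    if one of the two pairs of rates is constant, the order of the rates passes
    to the means and no reversal can occur. *)
Require Import Defs.
From Stdlib Require Import Reals Lra.

Local Open Scope R_scope.

Definition wmean (p1 p2 x1 x2 : R) : R := (p1 * x1 + p2 * x2) / (p1 + p2).

Lemma wmean_const (p1 p2 x : R) : 0 < p1 -> 0 < p2 -> wmean p1 p2 x x = x.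
Proof. intros; unfold wmean; field; lra. Qed.

Lemma wmean_lt (p1 p2 x1 x2 y1 y2 : R) :
  0 < p1 -> 0 < p2 -> x1 < y1 -> x2 < y2 ->
  wmean p1 p2 x1 x2 < wmean p1 p2 y1 y2.
Proof.
  intros Hp1 Hp2 H1 H2; unfold wmean, Rdiv.
  apply Rmult_lt_compat_r; [apply Rinv_0_lt_compat; lra |].
  apply Rplus_lt_compat; apply Rmult_lt_compat_l; assumption.
Qed.

(** Weights and values are kept abstract so that [SP1] and [SP2] are both instances, with the two
    rows exchanged. *)
Lemma wmean_reversal (p1 p2 q1 q2 x1 x2 y1 y2 : R) :
  0 < p1 -> 0 < p2 -> 0 < q1 -> 0 < q2 -> x1 < y1 -> x2 < y2 ->
  ~ wmean p1 p2 x1 x2 < wmean q1 q2 y1 y2 ->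
  x1 <> x2 /\ y1 <> y2 /\ (p1 <> q1 \/ p2 <> q2).
Proof.
  intros Hp1 Hp2 Hq1 Hq2 H1 H2 Hrev; repeat split.
  - intros <-; apply Hrev.
    (* The constant mean is re-expressed with the weights of the other side, so that [wmean_lt]
       applies. *)
    rewrite wmean_const, <- (wmean_const q1 q2 x1) by assumption.
    now apply wmean_lt.
  - intros <-; apply Hrev.
    rewrite (wmean_const q1 q2), <- (wmean_const p1 p2 y1) by assumption.
    now apply wmean_lt.
  - destruct (Req_dec p1 q1) as [<- | H]; [right | now left].
    intros <-; apply Hrev; now apply wmean_lt.
Qed.

Lemma alpha_pos (T : table) : 0 < alpha T.
Proof. exact (Rplus_lt_0_compat _ _ (ta_pos T) (tb_pos T)). Qed.

Lemma gamma_pos (T : table) : 0 < gamma T.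
Proof. exact (Rplus_lt_0_compat _ _ (tc_pos T) (td_pos T)). Qed.

Lemma mu_wmean (T1 T2 : table) :
  mu T1 T2 = wmean (alpha T1) (alpha T2) (rateA T1) (rateA T2).
Proof.
  pose proof (alpha_pos T1); pose proof (alpha_pos T2).
  unfold mu, wmean, rateA; field; lra.
Qed.

Lemma nu_wmean (T1 T2 : table) :
  nu T1 T2 = wmean (gamma T1) (gamma T2) (rateC T1) (rateC T2).
Proof.
  pose proof (gamma_pos T1); pose proof (gamma_pos T2).
  unfold nu, wmean, rateC; field; lra.
Qed.

Theorem theorem2 (T1 T2 : table) (hSP : simpson_paradox T1 T2) :
  rateA T1 <> rateA T2 /\
  rateC T1 <> rateC T2 /\
  (alpha T1 <> gamma T1 \/ alpha T2 <> gamma T2).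
Proof.
  pose proof (alpha_pos T1); pose proof (alpha_pos T2).
  pose proof (gamma_pos T1); pose proof (gamma_pos T2).
  destruct hSP as [(Hr1 & Hr2 & Hrev) | (Hr1 & Hr2 & Hrev)];
    rewrite mu_wmean, nu_wmean in Hrev.
  (* Under [SP1] the smaller rates are those of the second row, so the conclusions come out with
     [rateC] first and the weight inequalities flipped. *)
  - apply wmean_reversal in Hrev; try assumption.
    destruct Hrev as (HC & HA & [Hw | Hw]); auto.
  - now apply wmean_reversal in Hrev.
Qed.
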